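(* For every integer $n\geq 6$ there exist at least two non-isomorphic BCK-algebras $(X,\cdot,0)$ of order $n$ (i.e. with $|X|=n$) in which the sequences $$x_0\geq y_1\geq x_2\geq y_3,\qquad y_0\geq x_1\geq y_2\geq x_3$$ cannot be prolonged; that is, in each of these algebras there exist elements $x,y\in X$ such that, for the BCK-sequences $(x_k)_{k\ge 0}$ and $(y_k)_{k\ge 0}$ determined by $x$ and $y$, at least one of the inequalities $y_3\geq x_4$ and $x_3\geq y_4$ fails.
   Context: A BCK-algebra is an algebra $(X,\cdot,0)$, where $X$ is a non-empty set with a designated element $0$ and a binary operation $\cdot$ such that for all $x,y,z\in X$: (1) $((x\cdot y)\cdot(z\cdot y))\cdot(x\cdot z)=0$; (2) $(x\cdot(x\cdot y))\cdot y=0$; (3) $x\cdot 0=x$; (4) $0\cdot x=0$; (5) $x\cdot y=y\cdot x=0$ implies $x=y$. A BCK-algebra is partially ordered by the relation: $x\leq y$ iff $x\cdot y=0$ (and $y \ge x$ means $x\le y$). For elements $x,y$ of a BCK-algebra, the BCK-sequences determined by $x$ and $y$ are the sequences $(x_k)_{k\ge0}$, $(y_k)_{k\ge0}$ defined by $x_0=x$, $x_1=y\cdot(y\cdot x)$, $x_k=x_{k-2}\cdot(x_{k-2}\cdot x_{k-1})$ for $k\geq 2$; $y_0=y$, $y_1=x\cdot(x\cdot y)$, $y_k=y_{k-2}\cdot(y_{k-2}\cdot y_{k-1})$ for $k\geq 2$. In every BCK-algebra one has $x_0\geq y_1\geq x_2\geq y_3$ and $y_0\geq x_1\geq y_2\geq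 x_3$. Prolonging these sequences means continuing them with the next terms: $x_0\geq y_1\geq x_2\geq y_3\geq x_4\ge\cdots$ and $y_0\geq x_1\geq y_2\geq x_3\geq y_4\ge\cdots$. *)

(* Defs.v *)
From mathcomp Require Import all_boot.

Set Implicit Arguments.
Unset Strict Implicit.
Unset Printing Implicit Defensive.

Record is_bck_algebra (X : Type) (op : X -> X -> X) (zero : X) : Prop := {
  bck_ax1 : forall x y z, op (op (op x y) (op z y)) (op x z) = zero;
  bck_ax2 : forall x y, op (op x (op x y)) y = zero;
  bck_ax3 : forall x, op x zero = x;
  bck_ax4 : forall x, op zero x = zero;
  bck_ax5 : forall x y, op x y = zero -> op y x = zero -> x = y
}.

Record fin_bck_algebra := FinBCKAlgebra {
  bck_carrier :> finType;
  bck_op : bck_carrier -> bck_carrier -> bck_carrier;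
  bck_zero : bck_carrier;
  bck_axioms : is_bck_algebra bck_op bck_zero
}.

Definition bck_le (A : fin_bck_algebra) (x y : A) : Prop :=
  bck_op x y = bck_zero A.

Fixpoint bck_xseq (A : fin_bck_algebra) (x y : A) (k : nat) : A :=
  match k with
  | 0 => x
  | k1.+1 =>
      match k1 with
      | 0 => bck_op y (bck_op y x)
      | k2.+1 =>
          bck_op (bck_xseq x y k2)
                 (bck_op (bck_xseq x y k2) (bck_xseq x y k1))
      end
  end.

(* The recursion for [y_k] is that for [x_k] with the roles of [x] and [y]
   exchanged, including in the two initial terms. *)
Definition bck_yseq (A : fin_bck_algebra) (x y : A) (k : nat) : A :=
  bck_xseq y x k.

Definition bck_not_prolongable (A : fin_bck_algebra) : Prop :=
  exists x y : A,
    ~ bck_le (bck_xseq x y 4) (bck_yseq x y 3) \/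
    ~ bck_le (bck_yseq x y 4) (bck_xseq x y 3).

Definition bck_isomorphic (A B : fin_bck_algebra) : Prop :=
  exists f : A -> B,
    [/\ bijective f,
        f (bck_zero A) = bck_zero B
      & forall x y : A, f (bck_op x y) = bck_op (f x) (f y)].

(* Main.v *)
(** Two six-element tables, found by exhaustive search, violate
    [x_4 <= y_3] or [y_4 <= x_3]. Adjoining a new greatest element [t], with
    [t * a = t] for every old element [a], gives a BCK-algebra with one more
    element and the same BCK-sequences for old [x] and [y], and creates no new
    incomparable pairs. The first table has a single pair of incomparable
    elements, while the second has an element incomparable to two others, which
    distinguishes all the iterated extensions. *)
Require Import Defs.
From mathcomp Require Import all_boot.
From Corelib Require Import Setoid.

Set Implicit Arguments.
Unset Strict Implicit.
Unset Printing Implicit Defensive.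

Section AddTop.

Variable A : fin_bck_algebra.

Definition add_top_op (x y : option A) : option A :=
  match x, y with
  | Some a, Some b => Some (bck_op a b)
  | None, Some _ => None
  | _, None => Some (bck_zero A)
  end.

(** A case involving the top [None] is settled by computation, possibly with the laws [x * 0 = x]
    and [0 * x = 0]. *)
Lemma add_top_axioms : is_bck_algebra add_top_op (Some (bck_zero A)).
Proof.
case: (bck_axioms A) => ax1 ax2 ax3 ax4 ax5.
split.
- by move=> [x|] [y|] [z|] //=; rewrite ?ax1 ?ax3 ?ax4.
- by move=> [x|] [y|] //=; rewrite ?ax2 ?ax3 ?ax4.
- by move=> [x|] //=; rewrite ax3.
- by move=> [x|] //=; rewrite ax4.
- by move=> [x|] [y|] //= [xy] [yx]; rewrite (ax5 _ _ xy yx).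
Qed.

Definition add_top : fin_bck_algebra := FinBCKAlgebra add_top_axioms.

Lemma card_add_top : #|add_top| = #|A|.+1.
Proof. exact: card_option. Qed.

Lemma add_top_xseq (x y : A) k :
  bck_xseq (Some x : add_top) (Some y) k = Some (bck_xseq x y k).
Proof.
(* The recursion looks two terms back, so two consecutive indices go through the induction
   together. *)
suff: bck_xseq (Some x : add_top) (Some y) k = Some (bck_xseq x y k) /\
      bck_xseq (Some x : add_top) (Some y) k.+1 = Some (bck_xseq x y k.+1).
  by case.
elim: k => [|k [IHk IHk1]]; split=> //.
change (bck_xseq (Some x : add_top) (Some y) k.+2) with
  (add_top_op (bck_xseq (Some x : add_top) (Some y) k)
    (add_top_op (bck_xseq (Some x : add_top) (Some y) k)
       (bck_xseq (Some x : add_top) (Some y) k.+1))).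
by rewrite IHk IHk1.
Qed.

Lemma add_top_le_Some (a b : A) :
  bck_le (Some a : add_top) (Some b) <-> bck_le a b.
Proof. by split=> [[]|ab] //; congr Some. Qed.

Lemma add_top_not_prolongable :
  bck_not_prolongable A -> bck_not_prolongable add_top.
Proof.
move=> [x [y xyP]]; exists (Some x), (Some y).
rewrite /bck_yseq !add_top_xseq !add_top_le_Some.
exact: xyP.
Qed.

End AddTop.

Definition bck_incomparable (A : fin_bck_algebra) (x y : A) : Prop :=
  ~ bck_le x y /\ ~ bck_le y x.

(** The isomorphism invariant that separates the two families; [y] and [z] may be comparable to each
    other. *)
Definition has_two_incomparable (A : fin_bck_algebra) : Prop :=
  exists x y z : A,
    [/\ y <> z, bck_incomparable x y & bck_incomparable x z].

(** The top lies above every element, so it belongs to no incomparable pair. *)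
Lemma add_top_incomparable (A : fin_bck_algebra) (x y : add_top A) :
  bck_incomparable x y <->
  exists a b : A, [/\ x = Some a, y = Some b & bck_incomparable a b].
Proof.
split=> [|[a [b [-> ->]]]]; last first.
  by rewrite /bck_incomparable !add_top_le_Some.
case: x y => [a|] [b|] [xy yx]; try by [case: xy | case: yx].
exists a, b; split=> //.
by move: xy yx; rewrite !add_top_le_Some.
Qed.

Lemma add_top_has_two_incomparable (A : fin_bck_algebra) :
  has_two_incomparable (add_top A) <-> has_two_incomparable A.
Proof.
split=> [[x [y [z [yz]]]]|[x [y [z [yz xy xz]]]]].
  move=> /add_top_incomparable [a [b [-> yE ab]]].
  move=> /add_top_incomparable [a' [c [[<-] zE ac]]].
  by exists a, b, c; split=> // bc; apply: yz; rewrite yE zE bc.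
exists (Some x), (Some y), (Some z); split; first by case.
- by apply/add_top_incomparable; exists x, y.
- by apply/add_top_incomparable; exists x, z.
Qed.

Lemma isomorphic_has_two_incomparable (A B : fin_bck_algebra) :
  bck_isomorphic A B -> has_two_incomparable B -> has_two_incomparable A.
Proof.
move=> [f [[g fK gK] f0 fM]] [x [y [z [yz xy xz]]]].
(* Applying the homomorphism [f] shows that its inverse [g] reflects the order, hence preserves
   incomparability. *)
have g_le u v : bck_le (g u) (g v) -> bck_le u v.
  by rewrite /bck_le => /(congr1 f); rewrite fM !gK f0.
have g_incomparable u v :
    bck_incomparable u v -> bck_incomparable (g u) (g v).
  by move=> [uv vu]; split=> /g_le.
exists (g x), (g y), (g z); split; [|exact: g_incomparable..].
by move=> /(can_inj gK).
Qed.

(* Explicit, unlike [inord], so that it evaluates under [vm_compute]. *)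
Definition ord6 (i : nat) : 'I_6 := Ordinal (ltn_pmod i (isT : 0 < 6)).

Definition table_op (t : seq (seq nat)) (i j : 'I_6) : 'I_6 :=
  ord6 (nth 0 (nth [::] t i) j).

(** The order is the chain 0 < 1 < 2 < 3 with two maximal elements 4 and 5 above it. *)
Definition table1 : seq (seq nat) :=
  [:: [:: 0; 0; 0; 0; 0; 0];
      [:: 1; 0; 0; 0; 0; 0];
      [:: 2; 1; 0; 0; 0; 0];
      [:: 3; 1; 1; 0; 0; 0];
      [:: 4; 2; 1; 1; 0; 1];
      [:: 5; 3; 2; 1; 1; 0]].

(** The order is the chain 0 < 1 < 2, above which lie 3 and, separately, 4 < 5. *)
Definition table2 : seq (seq nat) :=
  [:: [:: 0; 0; 0; 0; 0; 0];
      [:: 1; 0; 0; 0; 0; 0];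
      [:: 2; 2; 0; 0; 0; 0];
      [:: 3; 2; 1; 0; 1; 1];
      [:: 4; 4; 4; 4; 0; 0];
      [:: 5; 4; 4; 4; 1; 0]].

(** Ranging over an explicit list keeps the checks computable by [vm_compute]. *)
Definition all_ord6 (P : pred 'I_6) : bool := all (P \o ord6) (iota 0 6).

Lemma all_ord6P (P : pred 'I_6) : reflect (forall i, P i) (all_ord6 P).
Proof.
apply: (iffP allP) => [PP i|PP i _ /=] //.
have -> : i = ord6 i by apply: val_inj; rewrite /= modn_small.
by apply: PP; rewrite mem_iota /=.
Qed.

Definition is_bck_table (t : seq (seq nat)) : bool :=
  let op := table_op t in
  [&& all_ord6 (fun x => all_ord6 (fun y => all_ord6 (fun z =>
        op (op (op x y) (op z y)) (op x z) == ord0))),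
      all_ord6 (fun x => all_ord6 (fun y => op (op x (op x y)) y == ord0)),
      all_ord6 (fun x => op x ord0 == x),
      all_ord6 (fun x => op ord0 x == ord0)
    & all_ord6 (fun x => all_ord6 (fun y =>
        (op x y == ord0) && (op y x == ord0) ==> (x == y)))].

Lemma is_bck_table_axioms (t : seq (seq nat)) :
  is_bck_table t -> is_bck_algebra (table_op t) ord0.
Proof.
case/and5P=> /all_ord6P ax1 /all_ord6P ax2 /all_ord6P ax3 /all_ord6P ax4.
move=> /all_ord6P ax5; split.
- by move=> x y z; move/all_ord6P: (ax1 x) => /(_ y)/all_ord6P/(_ z)/eqP.
- by move=> x y; move/all_ord6P: (ax2 x) => /(_ y)/eqP.
- by move=> x; apply/eqP.
- by move=> x; apply/eqP.
- move=> x y xy yx; move/all_ord6P: (ax5 x) => /(_ y).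
  by rewrite xy yx eqxx => /eqP.
Qed.

Lemma table1_axioms : is_bck_algebra (table_op table1) ord0.
Proof. by apply: is_bck_table_axioms; vm_compute. Qed.

Lemma table2_axioms : is_bck_algebra (table_op table2) ord0.
Proof. by apply: is_bck_table_axioms; vm_compute. Qed.

Definition bck1 : fin_bck_algebra := FinBCKAlgebra table1_axioms.
Definition bck2 : fin_bck_algebra := FinBCKAlgebra table2_axioms.

Lemma bck1_not_prolongable : bck_not_prolongable bck1.
Proof.
(* Here [x_3 = 1] and [y_4 = 2], while [2 * 1 = 1]: the inequality [y_4 <= x_3] fails. *)
exists (Ordinal (isT : 4 < 6)), (Ordinal (isT : 5 < 6)).
by first [left => /(congr1 val); done | right => /(congr1 val); done].
Qed.

Lemma bck2_not_prolongable : bck_not_prolongable bck2.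
Proof.
(* Here [x_4 = 1] and [y_3 = 0], so it is [x_4 <= y_3] that fails. *)
exists (Ordinal (isT : 3 < 6)), (Ordinal (isT : 5 < 6)).
by first [left => /(congr1 val); done | right => /(congr1 val); done].
Qed.

Lemma bck1_incomparable (x y : bck1) :
  bck_incomparable x y ->
  (val x == 4) && (val y == 5) || (val x == 5) && (val y == 4).
Proof.
have : all_ord6 (fun i => all_ord6 (fun j =>
    [|| table_op table1 i j == ord0, table_op table1 j i == ord0
      | (val i == 4) && (val j == 5) || (val i == 5) && (val j == 4)])).
  by vm_compute.
by move=> /all_ord6P/(_ x)/all_ord6P/(_ y)/or3P[/eqP xy [] //|/eqP yx []|].
Qed.

Lemma bck1_has_two_incomparable : ~ has_two_incomparable bck1.
Proof.
move=> [x [y [z [yz /bck1_incomparable xy /bck1_incomparable xz]]]].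
apply: yz; apply: val_inj.
(* Whether [x] is 4 or 5, its only possible partner is the other one, which forces [y] and [z] to
   coincide. *)
by case/orP: xy => /andP[/eqP xE /eqP ->]; move: xz;
  rewrite xE /= ?orbF => /eqP ->.
Qed.

Lemma bck2_has_two_incomparable : has_two_incomparable bck2.
Proof.
exists (Ordinal (isT : 3 < 6)), (Ordinal (isT : 4 < 6)), (Ordinal (isT : 5 < 6)).
by split=> [/(congr1 val)||] //; split=> /(congr1 val).
Qed.

Section IterAddTop.

Variables (A : fin_bck_algebra) (k : nat).

Lemma card_iter_add_top : #|iter k add_top A| = k + #|A|.
Proof. by elim: k => //= m IHm; rewrite card_add_top IHm. Qed.

Lemma iter_add_top_not_prolongable :
  bck_not_prolongable A -> bck_not_prolongable (iter k add_top A).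
Proof. by move=> nA; elim: k => //= m; apply: add_top_not_prolongable. Qed.

Lemma iter_add_top_has_two_incomparable :
  has_two_incomparable (iter k add_top A) <-> has_two_incomparable A.
Proof. by elim: k => //= m IHm; rewrite add_top_has_two_incomparable. Qed.

End IterAddTop.

Theorem theorem1 (n : nat) (hn : 6 <= n) :
  exists A B : fin_bck_algebra,
    [/\ #|A| = n /\ #|B| = n,
        ~ bck_isomorphic A B,
        bck_not_prolongable A
      & bck_not_prolongable B].
Proof.
(* Each new top adds one element to the initial six; [6 <= n] makes the truncated subtraction
   exact. *)
exists (iter (n - 6) add_top bck1), (iter (n - 6) add_top bck2); split.
- by rewrite !card_iter_add_top /= !card_ord subnK.
- move=> /isomorphic_has_two_incomparable; rewrite !iter_add_top_has_two_incomparable.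
  by move=> /(_ bck2_has_two_incomparable) /bck1_has_two_incomparable.
- exact: iter_add_top_not_prolongable bck1_not_prolongable.
- exact: iter_add_top_not_prolongable bck2_not_prolongable.
Qed.
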